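(* For integers $s,t\ge0$ let $m_{i,j}^{s,t}=\int_{(0,1)^2}\frac{x^{s+i}y^{s+j}}{x+y}\left(\frac{1-x}{1+x}\right)^t\left(\frac{1-y}{1+y}\right)^tdx\,dy$, $\phi_i^{s,t}=\sqrt2\int_0^1\frac{x^{s+i}}{1+x}\left(\frac{1-x}{1+x}\right)^tdx$, $\tau_n^{s,t}=\det(m_{i,j}^{s,t})_{i,j=0}^{n-1}$ ($\tau_0^{s,t}=1$), and $$\sigma_n^{s,t}=\det\begin{pmatrix} m_{0,0}^{s,t}&\cdots&m_{0,n-1}^{s,t}&\phi_0^{s,t}\\ \vdots&&\vdots&\vdots\\ m_{n,0}^{s,t}&\cdots&m_{n,n-1}^{s,t}&\phi_n^{s,t}\end{pmatrix}\quad(n\ge0),$$ and let $P_n^{s,t}(x)=\frac{1}{\tau_n^{s,t}}\det\begin{pmatrix} m_{0,0}^{s,t}&\cdots&m_{0,n-1}^{s,t}&1\\ \vdots&&\vdots&\vdots\\ m_{n,0}^{s,t}&\cdots&m_{n,n-1}^{s,t}&x^n\end{pmatrix}$, $P_0^{s,t}=1$. Then for every $n\ge1$ and $s,t\ge0$ with $\sigma_{n-1}^{s,t}\neq0$, $$P_n^{s,t+1}(x)+d_n^{s,t}P_{n-1}^{s,t+1}(x)=P_n^{s,t}(x)+e_n^{s,t}P_{n-1}^{s,t}(x),$$ where $$d_n^{s,t}=-\frac{\sigma_n^{s,t}\tau_{n-1}^{s,t+1}}{\sigma_{n-1}^{s,t}\tau_n^{s,t+1}},\qquad e_n^{s,t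}=-\frac{\sigma_n^{s,t}\tau_{n-1}^{s,t}}{\sigma_{n-1}^{s,t}\tau_n^{s,t}}.$$
   Context: Here $m_{i,j}^{s,t}=\langle x^i,y^j\rangle_{s,t}$ for the bilinear form $\langle f,g\rangle_{s,t}=\int_{(0,1)^2}\frac{x^sy^s}{x+y}f(x)g(y)\left(\frac{1-x}{1+x}\right)^t\left(\frac{1-y}{1+y}\right)^tdx\,dy$, and $\phi_i^{s,t}=\mathcal L_{s,t}(x^i)$ for the functional $\mathcal L_{s,t}(f)=\sqrt2\int_0^1\frac{x^s}{1+x}f(x)\left(\frac{1-x}{1+x}\right)^tdx$. The determinants $\tau_n^{s,t}$ are positive; $P_n^{s,t}$ is the monic Cauchy–Jacobi bi-orthogonal polynomial of degree $n$. The condition $\sigma_{n-1}^{s,t}\ne0$ is only what is needed for the coefficients to be defined. *)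

(* Defs.v *)
From HB Require Import structures.
From mathcomp Require Import all_boot all_order all_algebra.
From mathcomp Require Import all_classical all_reals all_analysis.
Set Implicit Arguments. Unset Strict Implicit. Unset Printing Implicit Defensive.
Import Order.TTheory GRing.Theory Num.Theory.
Local Open Scope classical_set_scope.
Local Open Scope ring_scope.

Section CJ.
Variable R : realType.

Definition cjw (t : nat) (x : R) : R := ((1 - x) / (1 + x)) ^+ t.

Definition cj_m (s t i j : nat) : R :=
  Rintegral ((@lebesgue_measure R) \x (@lebesgue_measure R))%E
    (`]0, 1[ `*` `]0, 1[)
    (fun p : R * R => p.1 ^+ (s + i) * p.2 ^+ (s + j) / (p.1 + p.2)
                      * cjw t p.1 * cjw t p.2).

Definition cj_phi (s t i : nat) : R :=
  Num.sqrt 2 * Rintegral (@lebesgue_measure R) `]0, 1[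
    (fun x : R => x ^+ (s + i) / (1 + x) * cjw t x).

Definition cj_tau (s t n : nat) : R :=
  \det (\matrix_(i < n, j < n) cj_m s t i j).

Definition cj_sigma (s t n : nat) : R :=
  \det (\matrix_(i < n.+1, j < n.+1)
          if (j < n)%N then cj_m s t i j else cj_phi s t i).

Definition cj_P (s t n : nat) : {poly R} :=
  (cj_tau s t n)^-1 *:
    \det (\matrix_(i < n.+1, j < n.+1)
            if (j < n)%N then (cj_m s t i j)%:P else 'X^i).

Definition cj_d (s t n : nat) : R :=
  - (cj_sigma s t n * cj_tau s t.+1 n.-1) / (cj_sigma s t n.-1 * cj_tau s t.+1 n).

Definition cj_e (s t n : nat) : R :=
  - (cj_sigma s t n * cj_tau s t n.-1) / (cj_sigma s t n.-1 * cj_tau s t n).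

End CJ.

(* Main.v *)
(**
  Write [u(x) = (1-x)/(1+x)]. The identity
  [1 - u(x) u(y) = 2 (x+y) / ((1+x) (1+y))] turns the step from t to t+1 into a
  rank-one update [m' i j = m i j - phi i * phi j]. With L the functional
  sending [x^i] to [phi i], both sides of the claimed equality are monic of
  degree n, killed by L (this fixes d and e, since column operations show that
  sigma is the same determinant for m and m'), and orthogonal for m' to 1, ...,
  x^(n-2). Their difference, of degree less than n, therefore solves a
  homogeneous system with determinant [sigma_(n-1) <> 0].

  The determinants tau do not vanish: if v is in the kernel of the Gram matrix
  at t, then [Q_k = v M^(t+k) v^T] starts at 0, decreases by [L_(t+k)(v)^2] at
  each step and tends to 0 by dominated convergence, so all [L_(t+k)(v)]
  vanish. Since [f(x) = sum v_i x^i] divided by [(1+x)^n] is a polynomial in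
  u(x), this gives [int x^s u^t f^2 / (1+x)^(n+1) = 0] and f = 0.
*)
Require Import Defs.
From HB Require Import structures.
From mathcomp Require Import all_boot all_order all_algebra.
From mathcomp Require Import all_classical all_reals all_analysis.
From mathcomp Require Import measurable_realfun ring lra.
Import Order.TTheory GRing.Theory Num.Theory.
Import numFieldNormedType.Exports.
Local Open Scope classical_set_scope.
Local Open Scope ring_scope.

(** * Bordered determinants over a field and their behaviour under rank-one updates *)

Section Bordered.
Variable F : fieldType.
Implicit Types (m : nat -> nat -> F) (a : nat -> F) (p : {poly F}) (n : nat).

Definition gram m n : 'M[F]_n := \matrix_(i < n, j < n) m i j.

Definition bordered m a n : 'M[F]_n.+1 :=
  \matrix_(i < n.+1, j < n.+1) if (j < n)%N then m i j else a i.

(** [cj_P] for arbitrary moments, with the same shape, so that the final theorem applies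
    [bipoly_rank1] by conversion. *)
Definition bipoly m n : {poly F} :=
  (\det (gram m n))^-1 *:
    \det (\matrix_(i < n.+1, j < n.+1)
            if (j < n)%N then (m i j)%:P else 'X^i).

(** The linear functional ['X^i] to [a i], cut off at a fixed [N] rather than [size p] so that
    linearity holds termwise. *)
Definition lfun N a p : F := \sum_(i < N) p`_i * a i.

Lemma lfunD N a p q : lfun N a (p + q) = lfun N a p + lfun N a q.
Proof. by rewrite -big_split; apply: eq_bigr => i _; rewrite coefD mulrDl. Qed.

Lemma lfunZ N a c p : lfun N a (c *: p) = c * lfun N a p.
Proof. by rewrite mulr_sumr; apply: eq_bigr => i _; rewrite coefZ mulrA. Qed.

Lemma lfun_widen N M a p : (size p <= N <= M)%N -> lfun M a p = lfun N a p.
Proof.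
case/andP => sp NM; rewrite /lfun -[in RHS](subnKC sp) -(subnKC (leq_trans sp NM)).
rewrite !big_split_ord /= [X in _ + X]big1 ?[X in _ = _ + X]big1 // => i _.
  by rewrite nth_default ?mul0r // leq_addr.
by rewrite nth_default ?mul0r // leq_addr.
Qed.

(** Laplace expansion along the last column. The cofactors there ignore that column, so the border
    [fun=> 0] is a placeholder. *)
Lemma bipolyE m n : bipoly m n =
  (\det (gram m n))^-1 *:
    \poly_(i < n.+1) cofactor (bordered m (fun=> 0) n) (inord i) ord_max.
Proof.
congr (_ *: _); rewrite (expand_det_col _ ord_max) poly_def.
apply: eq_bigr => i _; rewrite mxE ltnn inord_val mulrC /cofactor.
rewrite -mul_polyC rmorphM /= rmorphXn /= rmorphN1; congr (_ * _ * _).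
rewrite -det_map_mx; congr (\det _); apply/matrixP => k l.
by rewrite !mxE lift_max ltn_ord.
Qed.

Lemma size_bipoly m n : (size (bipoly m n) <= n.+1)%N.
Proof. by rewrite bipolyE (leq_trans (size_scale_leq _ _)) // size_poly. Qed.

(** The functional only affects the last column, replacing ['X^i] by [a i]; the cofactors are
    unchanged. *)
Lemma lfun_bipoly m n a :
  lfun n.+1 a (bipoly m n) = \det (bordered m a n) / \det (gram m n).
Proof.
rewrite bipolyE lfunZ mulrC; congr (_ * _).
rewrite (expand_det_col _ ord_max); apply: eq_bigr => i _.
rewrite coef_poly ltn_ord inord_val mxE ltnn mulrC /cofactor.
congr (_ * (_ * \det _)); apply/matrixP => k l.
by rewrite !mxE lift_max ltn_ord.
Qed.

Lemma bipoly_monic m n : \det (gram m n) != 0 -> (bipoly m n)`_n = 1.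
Proof.
move=> nz; rewrite bipolyE coefZ coef_poly ltnSn.
apply: (canLR (mulKf nz)); rewrite mulr1 /cofactor.
have -> : inord n = ord_max :> 'I_n.+1 by apply: val_inj; rewrite /= inordK.
(* The top coefficient is the corner cofactor, with sign [(-1)^(n+n) = 1] and minor [gram m n]. *)
rewrite /= addnn -signr_odd odd_double mul1r; congr (\det _).
by apply/matrixP => k l; rewrite !mxE lift_max ltn_ord lift_max.
Qed.

(** The border repeats column [j]; transposing turns the two equal columns into equal rows. *)
Lemma lfun_bipoly0 m n j : (j < n)%N -> lfun n.+1 (m^~ j) (bipoly m n) = 0.
Proof.
move=> jn; rewrite lfun_bipoly -det_tr.
rewrite (determinant_alternate (i1 := lift ord_max (Ordinal jn)) (i2 := ord_max)).
- by rewrite mul0r.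
- by rewrite eq_sym neq_lift.
by move=> k; rewrite !mxE lift_max /= jn ltnn.
Qed.

(** The conditions put the coefficient row of [p] in the left kernel of an invertible matrix. *)
Lemma lfun_inj m a n p : \det (bordered m a n) != 0 -> (size p <= n.+1)%N ->
  (forall j, (j < n)%N -> lfun n.+1 (m^~ j) p = 0) -> lfun n.+1 a p = 0 -> p = 0.
Proof.
move=> nz sp mp ap; pose v : 'rV[F]_n.+1 := \row_i p`_i.
have v0 : v = 0.
  apply/eqP; apply: contraNT nz => vnz; apply/det0P; exists v => //.
  apply/rowP => j; rewrite !mxE; case: (ltnP j n) => jn.
    by rewrite -[RHS](mp j jn); apply: eq_bigr => i _; rewrite !mxE jn.
  by rewrite -[RHS]ap; apply: eq_bigr => i _; rewrite !mxE ltnNge jn.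
apply/polyP => i; rewrite coef0; case: (ltnP i n.+1) => ni; last first.
  by rewrite nth_default // (leq_trans sp).
by have /rowP/(_ (Ordinal ni)) := v0; rewrite !mxE.
Qed.

(** Subtracting [a j] times the last column from each column [j < n] is right multiplication by the
    lower unitriangular [U]. *)
Lemma det_bordered_rank1 m a n :
  \det (bordered (fun i j => m i j - a i * a j) a n) = \det (bordered m a n).
Proof.
pose U : 'M[F]_n.+1 := \matrix_(i, j)
  if i == j then 1 else if (i == ord_max) then - a j else 0.
suff -> : bordered (fun i j => m i j - a i * a j) a n = bordered m a n *m U.
  rewrite det_mulmx [X in _ * X]det_trig.
    by rewrite big1 ?mulr1 // => i _; rewrite mxE eqxx.
  apply/is_trig_mxP => i j ij; rewrite mxE -!val_eqE /= !ltn_eqF //.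
  by rewrite (leq_trans ij) // -ltnS.
apply/matrixP => i j; rewrite !mxE big_ord_recr /= !mxE ltnn.
have [jn|nj] := ltnP j n.
  rewrite [ord_max == j]negbTE ?eqxx; last first.
    by apply: contraTneq jn => <-; rewrite ltnn.
  rewrite mulrN; congr (_ - _).
  rewrite (bigD1 (Ordinal jn)) //= big1 => [|k kj]; last first.
    rewrite !mxE -!val_eqE /= (ltn_eqF (ltn_ord k)).
    by rewrite [_ == _](negbTE kj) mulr0.
  by rewrite !mxE /= jn -val_eqE eqxx mulr1 addr0.
have -> : j = ord_max by apply: val_inj; apply/eqP; rewrite eqn_leq -ltnS ltn_ord.
rewrite eqxx mulr1 big1 ?add0r // => k _.
have nk : (widen_ord (leqnSn n) k == ord_max) = false.
  by rewrite -val_eqE /= ltn_eqF.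
by rewrite !mxE nk mulr0.
Qed.

(** The theorem for abstract moments, at index [n.+1]: [c m'] and [c m] become d and e. Both use the
    bordered determinants of [m], which agree with those of [m'] by [det_bordered_rank1]. *)
Lemma bipoly_rank1 m a n (m' := fun i j => m i j - a i * a j) :
  \det (gram m n) != 0 -> \det (gram m n.+1) != 0 ->
  \det (gram m' n) != 0 -> \det (gram m' n.+1) != 0 ->
  \det (bordered m a n) != 0 ->
  let c g := - (\det (bordered m a n.+1) * \det (gram g n))
             / (\det (bordered m a n) * \det (gram g n.+1)) in
  bipoly m' n.+1 + c m' *: bipoly m' n = bipoly m n.+1 + c m *: bipoly m n.
Proof.
move=> t0 t1 t'0 t'1 s0 c; pose q g := bipoly g n.+1 + c g *: bipoly g n.
have wide g b : lfun n.+2 b (bipoly g n) = lfun n.+1 b (bipoly g n).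
  by apply: lfun_widen; rewrite size_bipoly leqnSn.
have lqE b g : lfun n.+2 b (q g) =
    lfun n.+2 b (bipoly g n.+1) + c g * lfun n.+1 b (bipoly g n).
  by rewrite lfunD (lfunZ _ _ (c g)) wide.
(* [c g] is minus the ratio of the values of the functional [a] at [bipoly g n.+1] and
   [bipoly g n]. *)
have L g : \det (gram g n) != 0 -> \det (gram g n.+1) != 0 ->
    \det (bordered g a n) = \det (bordered m a n) ->
    \det (bordered g a n.+1) = \det (bordered m a n.+1) -> lfun n.+2 a (q g) = 0.
  move=> g0 g1 e0 e1; rewrite lqE !lfun_bipoly e0 e1 /c.
  by field; rewrite g0 g1 s0.
have O g j : (j < n)%N -> lfun n.+2 (g^~ j) (q g) = 0.
  move=> jn; rewrite lqE !lfun_bipoly0 ?mulr0 ?addr0 //.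
  exact: ltnW.
have L0 : lfun n.+2 a (q m) = 0 by apply: L.
have L1 : lfun n.+2 a (q m') = 0 by apply: L; rewrite ?det_bordered_rank1.
(* Column [j] of [m'] is column [j] of [m] minus [a j] times [a], and [q m] is killed by both. *)
have ortho j : (j < n)%N -> lfun n.+2 (m'^~ j) (q m) = 0.
  move=> jn; rewrite -[RHS](O m j jn) -[RHS]subr0 -[X in _ - X](mul0r (a j)) -L0.
  by rewrite /lfun mulr_suml -sumrB; apply: eq_bigr => i _; rewrite mulrBr mulrA.
apply/eqP; rewrite -subr_eq0 -/(q m') -/(q m); apply/eqP.
(* Both combinations are monic of degree [n.+1], so their top coefficients cancel. *)
have sD : (size (q m' - q m)%R <= n.+1)%N.
  apply/leq_sizeP => i; rewrite leq_eqVlt => /orP[/eqP <-|ni].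
    have lead g : \det (gram g n.+1) != 0 -> (q g)`_n.+1 = 1.
      move=> g1; rewrite coefD (coefZ (c g)) bipoly_monic //.
      by rewrite (nth_default _ (size_bipoly _ _)) mulr0 addr0.
    by rewrite coefB !lead // subrr.
  have big g : (size (q g) <= i)%N.
    apply: leq_trans ni; apply: leq_trans (size_polyD _ _) _.
    rewrite geq_max size_bipoly (leq_trans (size_scale_leq _ _)) //.
    exact: leq_trans (size_bipoly _ _) _.
  by rewrite coefB !nth_default ?subrr.
have nar b : lfun n.+1 b (q m' - q m) = lfun n.+2 b (q m') - lfun n.+2 b (q m).
  rewrite -(@lfun_widen n.+1 n.+2) ?sD ?leqnSn // lfunD -scaleN1r lfunZ.
  by rewrite mulN1r.
apply: (@lfun_inj m' a n) => //; first by rewrite det_bordered_rank1.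
  by move=> j jn; rewrite nar O // ortho // subrr.
by rewrite nar L0 L1 subrr.
Qed.

End Bordered.

(** * Measurability of inverses, and Fubini for products of one-variable functions *)

Lemma measurable_funV d (T : measurableType d) (R : realType) (D : set T)
  (f : T -> R) : measurable_fun D f -> measurable_fun D (fun x => (f x)^-1).
Proof.
(* Away from 0 inversion is continuous; on the singleton of 0 every function is measurable. *)
apply: measurableT_comp; rewrite -(setUCl [set 0 : R]).
apply/measurable_funU => //; first exact: measurableC.
split; last exact: measurable_fun_set1.
apply: open_continuous_measurable_fun.
  by rewrite openC; exact: closed_eq.
by move=> x; rewrite inE => /eqP x0; exact: inv_continuous.
Qed.

Section Tensor.
Context {d1 d2} {T1 : measurableType d1} {T2 : measurableType d2} {R : realType}.
Variables (m1 : {sigma_finite_measure set T1 -> \bar R})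
  (m2 : {sigma_finite_measure set T2 -> \bar R}).
Local Open Scope ereal_scope.

(** Tonelli: the inner integral of the absolute value is [|f x|] times a finite constant. *)
Lemma integrable_tensorT (f : T1 -> R) (g : T2 -> R) :
  m1.-integrable setT (EFin \o f) -> m2.-integrable setT (EFin \o g) ->
  (m1 \x m2).-integrable setT (fun p => (f p.1 * g p.2)%:E).
Proof.
move=> intf intg; have /measurable_EFinP mf := measurable_int _ intf.
have /measurable_EFinP mg := measurable_int _ intg.
apply/integrable12ltyP.
  by apply/measurable_EFinP/measurable_funM; apply: measurableT_comp.
have E x : \int[m2]_y `|(f x * g y)%:E| = `|f x|%:E * \int[m2]_y `|(g y)%:E|.
  under eq_integral do rewrite EFinM abseM.
  rewrite ge0_integralZl//.
  exact: (measurableT_comp _ (measurable_int _ intg)).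
rewrite (eq_integral (fun x => `|f x|%:E * \int[m2]_y `|(g y)%:E|)); last first.
  by move=> x _; exact: E.
rewrite ge0_integralZr//; last 2 first.
- by apply/measurable_EFinP; exact: measurableT_comp.
- exact: integral_ge0.
move/integrableP : intf => [_ fi]; move/integrableP : intg => [_ gi].
by rewrite lte_mul_pinfty ?integral_ge0 // ge0_fin_numE ?integral_ge0.
Qed.

Lemma Rintegral_tensorT (f : T1 -> R) (g : T2 -> R) :
  m1.-integrable setT (EFin \o f) -> m2.-integrable setT (EFin \o g) ->
  (Rintegral (m1 \x m2) setT (fun p => f p.1 * g p.2) =
   Rintegral m1 setT f * Rintegral m2 setT g)%R.
Proof.
move=> intf intg; rewrite [LHS]/Rintegral -integral12_prod_meas1/=; last first.
  exact: integrable_tensorT.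
have E x : \int[m2]_y (f x * g y)%:E = (f x)%:E * (\int[m2]_y (g y)%:E).
  under eq_integral do rewrite EFinM.
  by rewrite integralZl.
rewrite /fubini_F /= (eq_integral (fun x => (f x)%:E * \int[m2]_y (g y)%:E)).
  rewrite -(fineK (integrable_fin_num _ intg)) // integralZr // fineM //.
  exact: integrable_fin_num.
by move=> x _; exact: E.
Qed.

End Tensor.

Section TensorOn.
Context {d1 d2} {T1 : measurableType d1} {T2 : measurableType d2} {R : realType}.
Variables (m1 : {sigma_finite_measure set T1 -> \bar R})
  (m2 : {sigma_finite_measure set T2 -> \bar R}).

(** Extension by zero commutes with the product, which reduces rectangles to the whole space. *)
Lemma patch_tensor (A : set T1) (B : set T2) (f : T1 -> R) (g : T2 -> R) :
  (fun p => f p.1 * g p.2) \_ (A `*` B) =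
  (fun p => (f \_ A) p.1 * (g \_ B) p.2).
Proof.
apply/funext => -[x y]; rewrite !patchE in_setX /=.
by case: (x \in A); case: (y \in B); rewrite ?mul0r ?mulr0.
Qed.

Lemma integrable_patch {d} {T : measurableType d} (mu : {measure set T -> \bar R})
  (A : set T) (f : T -> R) : measurable A ->
  mu.-integrable A (EFin \o f) <-> mu.-integrable setT (EFin \o (f \_ A)).
Proof.
move=> mA; rewrite -restrict_EFin.
have := @integrable_restrict _ _ _ mu A mA setT measurableT (EFin \o f).
by rewrite setTI.
Qed.

Context {A : set T1} {B : set T2} {f : T1 -> R} {g : T2 -> R}.
Hypotheses (mA : measurable A) (mB : measurable B)
  (intf : m1.-integrable A (EFin \o f)) (intg : m2.-integrable B (EFin \o g)).

Lemma integrable_tensor :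
  (m1 \x m2)%E.-integrable (A `*` B) (fun p => (f p.1 * g p.2)%:E).
Proof.
apply/(@integrable_patch _ _ _ _ (fun p => f p.1 * g p.2)).
  exact: measurableX.
rewrite patch_tensor; apply: integrable_tensorT.
  by apply/(integrable_patch m1 A f mA).
by apply/(integrable_patch m2 B g mB).
Qed.

Lemma Rintegral_tensor :
  Rintegral (m1 \x m2)%E (A `*` B) (fun p => f p.1 * g p.2) =
  Rintegral m1 A f * Rintegral m2 B g.
Proof.
rewrite Rintegral_mkcond patch_tensor Rintegral_tensorT; last 2 first.
- by apply/(integrable_patch m1 A f mA).
- by apply/(integrable_patch m2 B g mB).
by rewrite -!Rintegral_mkcond.
Qed.

End TensorOn.

(** * Integrability of the Cauchy kernel on the unit square *)

Section CauchyKernel.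
Variable R : realType.
Notation mu := (@lebesgue_measure R).

(** The integrand is the derivative of the square root. Its integral over [1/(n+2), 1] is at most 1,
    and monotone convergence carries the bound to (0, 1]. *)
Lemma integrable_derive_sqrt :
  mu.-integrable `]0, 1[ (fun x => (2 * Num.sqrt x)^-1%:E).
Proof.
pose f (x : R) : R := (2 * Num.sqrt x)^-1.
have f0 x : 0 <= f x by rewrite invr_ge0 mulr_ge0 // sqrtr_ge0.
have mf D : measurable_fun D (EFin \o f).
  apply/measurable_EFinP; apply: (measurable_funS measurableT) => //.
  apply: measurable_funV; apply: measurable_funM => //.
  by apply: continuous_measurable_fun; exact: sqrt_continuous.
pose J : set R := [set` `]0, 1]].
apply: (@integrableS _ _ _ mu J); [exact: measurable_itv..| |].
  by apply: subset_itvl; rewrite bnd_simp.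
apply/integrableP; split; first exact: mf.
suff : (\int[mu]_(x in J) (f x)%:E < +oo)%E.
  apply: le_lt_trans; rewrite le_eqVlt; apply/orP; left; apply/eqP.
  by apply: eq_integral => x _; rewrite gee0_abs // lee_fin f0.
(* The shift [n.+2] keeps the left endpoint strictly below 1, as the fundamental theorem of calculus
   demands. *)
pose F (n : nat) : set R := [set` `[n.+2%:R^-1, 1]].
have -> : J = \bigcup_n F n.
  apply/seteqP; split => x; rewrite /J /= ?in_itv /=.
    case/andP => x0 x1; have [k xk] := ltr_add_invr x0.
    exists k => //; rewrite /F /= in_itv /= x1 andbT.
    rewrite (le_trans _ (ltW xk)) // add0r lef_pV2 ?posrE // ler_nat.
    by [].
  case=> n _; rewrite /F /= in_itv /= => /andP[nx ->]; rewrite andbT.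
  by rewrite (lt_le_trans _ nx) // invr_gt0.
have ndF : {homo F : n m / (n <= m)%N >-> (n <= m)%O}.
  move=> n m nm; rewrite subsetEset; apply: subset_itvr; rewrite bnd_simp.
  by rewrite lef_pV2 ?posrE // ler_nat.
have := @ge0_nondecreasing_set_cvg_integral _ (measurableTypeR R) R F (EFin \o f) mu ndF
  (fun=> measurable_itv _) (fun=> mf _).
have F0 (n : nat) x : F n x -> (0 <= (EFin \o f) x)%E by rewrite lee_fin.
move=> /(_ F0) cv.
apply: (@le_lt_trans _ _ 1%:E); last exact: ltry.
rewrite -(cvg_lim _ cv) //; apply: lime_le; first by apply/cvg_ex; eexists; exact: cv.
near=> n.
have n1 : n.+2%:R^-1 < 1 :> R by rewrite invf_lt1 // ltr1n.
have pos (x : R) : n.+2%:R^-1 <= x -> 0 < x.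
  by apply: lt_le_trans; rewrite invr_gt0.
rewrite (@continuous_FTC2 _ f Num.sqrt) //.
- by rewrite sqrtr1 -EFinB lee_fin gerBl sqrtr_ge0.
- apply: continuous_in_subspaceT => x; rewrite inE /= in_itv /= => /andP[/pos x0 _].
  apply: cvgV; first by rewrite mulf_neq0 // gt_eqF // sqrtr_gt0.
  by apply: cvgM; [exact: cvg_cst|exact: sqrt_continuous].
- split.
  + move=> x; rewrite in_itv /= => /andP[/ltW/pos x0 _].
    by have [] := is_derive1_sqrt x0.
  + by apply: cvg_at_right_filter; exact: sqrt_continuous.
  + by apply: cvg_at_left_filter; exact: sqrt_continuous.
- move=> x; rewrite in_itv /= => /andP[/ltW/pos x0 _].
  by rewrite derive1E derive_sqrt.
Unshelve. all: by end_near. Qed.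

Notation I01 := (`]0, 1[%classic : set R).

(* AM-GM: [1 / (x + y) <= 1 / (2 sqrt x sqrt y)], a product of integrable functions. *)
Lemma integrable_invD :
  (mu \x mu)%E.-integrable (I01 `*` I01) (fun p => (p.1 + p.2)^-1%:E).
Proof.
have mI := measurableX (measurable_itv `]0, 1[) (measurable_itv `]0, 1[) :
  measurable (I01 `*` I01).
have J : (mu \x mu)%E.-integrable (I01 `*` I01)
    (fun p => 2%:E * ((2 * Num.sqrt p.1)^-1 * (2 * Num.sqrt p.2)^-1)%:E)%E.
  apply: integrableZl => //.
  have S := integrable_derive_sqrt.
  exact: (integrable_tensor mu mu (measurable_itv _) (measurable_itv _) S S).
apply: le_integrable J => //.
  apply/measurable_EFinP; apply: measurable_funV.
  by apply: (measurable_funS measurableT) => //; apply: measurable_funD.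
move=> [x y] [] /=; rewrite !in_itv /= => /andP[x0 _] /andP[y0 _].
rewrite lee_fin !ger0_norm; last 2 first.
- by rewrite !mulr_ge0 ?invr_ge0 ?mulr_ge0 ?sqrtr_ge0.
- by rewrite invr_ge0 addr_ge0 ?ltW.
have sx : 0 < Num.sqrt x by rewrite sqrtr_gt0.
have sy : 0 < Num.sqrt y by rewrite sqrtr_gt0.
have -> : 2 * ((2 * Num.sqrt x)^-1 * (2 * Num.sqrt y)^-1) =
    (2 * (Num.sqrt x * Num.sqrt y))^-1 by field; rewrite !gt_eqF.
rewrite lef_pV2 ?posrE ?addr_gt0 ?mulr_gt0 //.
have := sqr_ge0 (Num.sqrt x - Num.sqrt y).
by rewrite sqrrB !sqr_sqrtr ?(ltW x0) ?(ltW y0) // -[x]/(x : R) -[y]/(y : R); lra.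
Qed.
End CauchyKernel.

(** * The Cauchy-Jacobi moments: their step in t and their limit for large t *)

Section CauchyJacobi.
Context {R : realType}.
Notation mu := (@lebesgue_measure R).
Notation I01 := (`]0, 1[%classic : set R).
Implicit Types (s t i j : nat) (x y : R) (p : R * R).

Definition cayley x : R := (1 - x) / (1 + x).

(** The integrand of [cj_m]; [cj_density] is that of [cj_phi] without the factor sqrt 2. *)
Definition cj_kernel s t i j p : R :=
  p.1 ^+ (s + i) * p.2 ^+ (s + j) / (p.1 + p.2) * cjw t p.1 * cjw t p.2.

Definition cj_density s t i x : R := x ^+ (s + i) / (1 + x) * cjw t x.

Lemma I01P x : I01 x -> 0 < x < 1.
Proof. by rewrite /= in_itv. Qed.

Lemma cayley_itv x : I01 x -> 0 < cayley x < 1.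
Proof.
move=> /I01P /andP[x0 x1]; rewrite /cayley divr_gt0 ?subr_gt0 ?addr_gt0 //=.
by rewrite ltr_pdivrMr ?addr_gt0 //; lra.
Qed.

Lemma cjwE t x : cjw t x = cayley x ^+ t. Proof. by []. Qed.

Lemma cjw_itv t x : I01 x -> 0 <= cjw t x <= 1.
Proof.
move=> /cayley_itv /andP[/ltW u0 /ltW u1].
by rewrite cjwE exprn_ge0 // exprn_ile1.
Qed.

Lemma measurable_cjw t D : measurable_fun D (@cjw R t).
Proof.
apply: measurable_funX; apply: measurable_funM; first exact: measurable_funB.
by apply: measurable_funV; exact: measurable_funD.
Qed.

Lemma measurable_cj_kernel s t i j D : measurable_fun D (cj_kernel s t i j).
Proof.
apply: (measurable_funS measurableT) => //.
do 2 (apply: measurable_funM; last by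
  apply: measurableT_comp => //; exact: measurable_cjw).
apply: measurable_funM; last by apply: measurable_funV; exact: measurable_funD.
by apply: measurable_funM; apply: measurable_funX.
Qed.

Lemma measurable_cj_density s t i D : measurable_fun D (cj_density s t i).
Proof.
apply: measurable_funM; last exact: measurable_cjw.
apply: measurable_funM; first exact: measurable_funX.
by apply: measurable_funV; exact: measurable_funD.
Qed.

Lemma measurable_square :
  measurable (I01 `*` I01 : set (measurableTypeR R * measurableTypeR R)).
Proof. by apply: measurableX; exact: measurable_itv. Qed.

(** Every factor other than the Cauchy kernel lies in [0, 1]. The bound is independent of t, hence
    fit for dominated convergence. *)
Lemma cj_kernel_itv s t i j p : (I01 `*` I01) p ->
  0 <= cj_kernel s t i j p <= (p.1 + p.2)^-1 .
Proof.
move=> [xI yI]; have /andP[x0 x1] := I01P _ xI; have /andP[y0 y1] := I01P _ yI.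
have /andP[u0 u1] := cjw_itv t _ xI; have /andP[v0 v1] := cjw_itv t _ yI.
have xy : 0 <= (p.1 + p.2)^-1 by rewrite invr_ge0 addr_ge0 ?ltW.
have X k : 0 <= p.1 ^+ k <= 1 by rewrite exprn_ge0 ?exprn_ile1 ?ltW.
have Y k : 0 <= p.2 ^+ k <= 1 by rewrite exprn_ge0 ?exprn_ile1 ?ltW.
have /andP[X0 X1] := X (s + i)%N; have /andP[Y0 Y1] := Y (s + j)%N.
rewrite /cj_kernel !mulr_ge0 //=.
have -> a b c d e : a * b * c * d * e = c * (a * b * d * e) :> R by ring.
rewrite ler_piMr //.
by do 3 (apply: mulr_ile1; rewrite ?mulr_ge0 //).
Qed.

Lemma cj_density_itv s t i x : I01 x -> 0 <= cj_density s t i x <= 1.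
Proof.
move=> xI; have /andP[x0 x1] := I01P _ xI; have /andP[u0 u1] := cjw_itv t _ xI.
have x10 : 0 < 1 + x by rewrite addr_gt0.
have i0 : 0 <= (1 + x)^-1 by rewrite invr_ge0 ltW.
have i1 : (1 + x)^-1 <= 1 by rewrite invf_le1 // lerDl ltW.
have X0 : 0 <= x ^+ (s + i) by rewrite exprn_ge0 // ltW.
have X1 : x ^+ (s + i) <= 1 by rewrite exprn_ile1 // ltW.
by rewrite /cj_density !mulr_ge0 //=; do 2 (apply: mulr_ile1; rewrite ?mulr_ge0 //).
Qed.

Lemma integrable_cj_kernel s t i j :
  (mu \x mu)%E.-integrable (I01 `*` I01) (EFin \o cj_kernel s t i j).
Proof.
apply: le_integrable (integrable_invD R); first exact: measurable_square.
  by apply/measurable_EFinP; exact: measurable_cj_kernel.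
move=> p /(cj_kernel_itv s t i j) /andP[k0 k1].
by rewrite lee_fin !ger0_norm // (le_trans k0).
Qed.

Lemma lebesgue_measure_I01 : mu I01 = 1%:E.
Proof. by rewrite lebesgue_measure_itv /= lte_fin ltr01 oppr0 adde0. Qed.

Lemma integrable_cj_density s t i : mu.-integrable I01 (EFin \o cj_density s t i).
Proof.
apply: (@le_integrable _ _ _ mu _ _ _ (cst 1%:E)).
- exact: measurable_itv.
- by apply/measurable_EFinP; exact: measurable_cj_density.
- move=> x /(cj_density_itv s t i) /andP[k0 k1].
  by rewrite lee_fin !ger0_norm.
- apply/integrableP; split; first exact: measurable_cst.
  under eq_integral do rewrite /= normr1.
  rewrite integral_cst; last exact: measurable_itv.
  rewrite [X in (_ * X)%E](_ : _ = 1%:E); last exact: lebesgue_measure_I01.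
  by rewrite mul1e ltry.
Qed.

(** The factor [x + y] in [1 - u(x) u(y)] cancels the Cauchy denominator, so the variables
    separate. *)
Lemma cj_kernelS s t i j p : (I01 `*` I01) p -> cj_kernel s t.+1 i j p =
  cj_kernel s t i j p - 2 * (cj_density s t i p.1 * cj_density s t j p.2).
Proof.
move=> [xI yI]; have /andP[x0 x1] := I01P _ xI; have /andP[y0 y1] := I01P _ yI.
rewrite /cj_kernel /cj_density !cjwE !exprS /cayley; field.
by rewrite !gt_eqF ?addr_gt0.
Qed.

Lemma cj_mS s t i j :
  cj_m R s t.+1 i j = cj_m R s t i j - cj_phi R s t i * cj_phi R s t j.
Proof.
have tensor := integrable_tensor mu mu (measurable_itv _) (measurable_itv _)
  (integrable_cj_density s t i) (integrable_cj_density s t j).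
have -> : cj_m R s t.+1 i j = Rintegral (mu \x mu)%E (I01 `*` I01)
    (fun p => cj_kernel s t i j p - 2 * (cj_density s t i p.1 * cj_density s t j p.2)).
  by apply: eq_Rintegral => p; rewrite inE; exact: cj_kernelS.
rewrite RintegralB; last 3 first.
- exact: measurable_square.
- exact: integrable_cj_kernel.
- exact: (integrableZl measurable_square 2 tensor).
rewrite RintegralZl; [|exact: measurable_square|exact: tensor].
(* The 2 is absorbed as the square of the factor sqrt 2 in [cj_phi]. *)
congr (_ - _); rewrite /cj_phi mulrACA -expr2 sqr_sqrtr //; congr (_ * _).
by apply: Rintegral_tensor; try exact: measurable_itv; exact: integrable_cj_density.
Qed.

Lemma cj_kernelE s t i j p :
  cj_kernel s t i j p = cj_kernel s 0%N i j p * (cayley p.1 * cayley p.2) ^+ t.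
Proof. by rewrite /cj_kernel !cjwE !expr0 !mulr1 [in RHS]exprMn mulrA. Qed.

(** Pointwise the kernel decays like a power of [u(x) u(y) < 1], and the Cauchy kernel dominates. *)
Lemma cvg_cj_m s i j : cj_m R s t i j @[t --> \oo] --> 0.
Proof.
have -> : 0 = fine (\int[(mu \x mu)%E]_(p in I01 `*` I01) cst 0 p)%E.
  by rewrite integral0.
apply: fine_cvg; rewrite fineK ?integral0 //.
rewrite -[X in _ --> X](integral0 (mu \x mu)%E (I01 `*` I01)).
apply: (dominated_cvg measurable_square (g := fun p => (p.1 + p.2)^-1%:E)).
- by move=> t; apply/measurable_EFinP; exact: measurable_cj_kernel.
- move=> p [xI yI]; apply: cvg_EFin; first exact: nearW.
  have /andP[u0 u1] := cayley_itv _ xI; have /andP[v0 v1] := cayley_itv _ yI.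
  rewrite [X in X @ _ --> _](_ : _ = fun t => cj_kernel s 0%N i j p *
     (cayley p.1 * cayley p.2) ^+ t); last first.
    by apply/funext => t; exact: cj_kernelE.
  rewrite -[X in _ --> X](mulr0 (cj_kernel s 0%N i j p)).
  apply: cvgM; first exact: cvg_cst.
  apply: cvg_expr; rewrite ger0_norm; last exact: ltW (mulr_gt0 u0 v0).
  exact: mulr_ilt1 (ltW u0) (ltW v0) u1 v1.
- by move=> p _; rewrite fin_numE.
- exact: integrable_invD.
- move=> t p /(cj_kernel_itv s t i j) /andP[k0 k1].
  by rewrite lee_fin ger0_norm.
Qed.

End CauchyJacobi.

(** * Integrals of finite combinations, and nonnegative functions of zero integral *)

Lemma integrable_lincomb {d} {T : measurableType d} {R : realType}
  (mu : {measure set T -> \bar R}) (D : set T) I (r : seq I) (c : I -> R)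
  (f : I -> T -> R) : measurable D ->
  (forall i, mu.-integrable D (EFin \o f i)) ->
  mu.-integrable D (EFin \o (fun x => \sum_(i <- r) c i * f i x)) /\
  Rintegral mu D (fun x => \sum_(i <- r) c i * f i x) =
  \sum_(i <- r) c i * Rintegral mu D (f i).
Proof.
move=> mD intf; elim: r => [|i r [IH1 IH2]].
  have E : (fun x : T => \sum_(i <- [::]) c i * f i x) = cst 0.
    by apply/funext => x; rewrite big_nil.
  rewrite big_nil E; split; first exact: integrable0.
  by rewrite /Rintegral integral0.
have E : (fun x : T => \sum_(i <- i :: r) c i * f i x) =
    (fun x => c i * f i x + \sum_(i <- r) c i * f i x).
  by apply/funext => x; rewrite big_cons.
have cf : mu.-integrable D (EFin \o (fun x => c i * f i x)).
  by have := integrableZl mD (c i) (intf i).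
rewrite big_cons E; split; first exact: (integrableD mD cf IH1).
by rewrite RintegralD // IH2 RintegralZl.
Qed.

Lemma finite_roots {R : idomainType} (p : {poly R}) :
  p != 0 -> finite_set [set x | root p x].
Proof.
move=> p0; apply: contrapT => /(infinite_set_fset (size p))[B Bp].
apply/negP; rewrite -ltnNge; apply: max_poly_roots => //; last first.
  exact: finmap.fset_uniq.
by apply/allP => x xB; apply: Bp.
Qed.

(** Such an [F] vanishes almost everywhere. For nonzero [p], a null set and finitely many roots
    would then cover (0, 1), which has measure 1. *)
Lemma Rintegral_eq0_itv01 {R : realType} (F : R -> R) (p : {poly R}) :
  lebesgue_measure.-integrable `]0, 1[ (EFin \o F) ->
  (forall x, 0 < x < 1 -> 0 <= F x) ->
  (forall x, 0 < x < 1 -> F x = 0 -> root p x) ->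
  Rintegral lebesgue_measure `]0, 1[ F = 0 -> p = 0.
Proof.
set mu := lebesgue_measure; pose I01 : set R := [set` `]0, 1[].
move=> intF F0 Fp intF0; apply/eqP; apply: contrapT => /negP p0.
have mF := measurable_int _ intF.
have mI : measurable I01 by exact: measurable_itv.
have : (\int[mu]_(x in I01) `|(EFin \o F) x| = 0)%E.
  rewrite -[RHS]/(0%:E) -intF0 /Rintegral fineK; last exact: integrable_fin_num.
  apply: eq_integral => x; rewrite inE /I01 /= in_itv /= => /F0 Fx.
  by rewrite ger0_norm.
move/(ae_eq_integral_abs mu mI mF) => [N [mN N0 subN]].
have roots_countable : countable [set x | root p x].
  exact: finite_set_countable (finite_roots p p0).
have Np : mu [set x | root p x] = 0%E by exact: countable_lebesgue_measure0.
have mp : measurable ([set x | root p x] : set (measurableTypeR R)).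
  by apply: countable_measurable => // x; exact: measurable_set1.
have muI : mu I01 = 0%E.
  apply: (@subset_measure0 _ _ _ mu I01 (N `|` [set x | root p x])) => //.
  - exact: measurableU.
  - move=> x Ix; have [?|nr] := boolP (root p x); [by right|left].
    apply: subN => /= /(_ Ix) [] /Fp; move: Ix; rewrite /I01 /= in_itv /= => Ix.
    by move=> /(_ Ix); exact/negP.
  - exact: (@null_set_setU _ _ _ mu _ _ mN mp N0 Np).
have /eqP := etrans (esym muI) (@lebesgue_measure_I01 R).
by rewrite eqe eq_sym oner_eq0.
Qed.

(** * Nonvanishing of the Gram determinants *)

Section Nondegenerate.
Context {R : realType}.
Notation mu := (@lebesgue_measure R).
Notation I01 := (`]0, 1[%classic : set R).

(* [x = (1 - u) / (1 + u)] and [1 + u = 2 / (1 + x)] for [u = cayley x]. *)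
Lemma poly_cayley n (v : 'I_n -> R) : exists q : {poly R},
  forall x, 0 < x < 1 -> q.[cayley x] = (\sum_i v i * x ^+ i) / (1 + x) ^+ n.
Proof.
exists (\sum_(i < n) v i *: ((2^-1 *: (1 + 'X)) ^+ (n - i) *
                             (2^-1 *: (1 - 'X)) ^+ i)).
move=> x /andP[x0 _]; have x1 : 1 + x != 0 by rewrite gt_eqF // addr_gt0.
rewrite horner_sum mulr_suml; apply: eq_bigr => i _.
rewrite hornerZ hornerM !horner_exp !hornerZ !hornerE.
rewrite -[RHS]mulrA -?[LHS]mulrA; congr (_ * _).
have -> : 2^-1 * (1 + cayley x) = (1 + x)^-1 by rewrite /cayley; field.
have -> : 2^-1 * (1 - cayley x) = x / (1 + x) by rewrite /cayley; field.
by rewrite expr_div_n mulrCA -!exprVn -exprD subnK // ltnW.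
Qed.

(** Weighting the k-th vanishing moment by the k-th coefficient of the [q] from [poly_cayley] turns
    the factor [q(u)] into [f / (1 + x)^n], so a square appears under the integral. *)
Lemma phi_moments_inj n s t (v : 'I_n -> R) :
  (forall k, \sum_i v i * cj_phi R s (t + k) i = 0) -> forall i, v i = 0.
Proof.
move=> phi0; have [q qE] := poly_cayley n v.
pose I k (i : 'I_n) := Rintegral mu I01 (cj_density s (t + k) i).
have I0 k : \sum_i v i * I k i = 0.
  have /eqP := phi0 k; rewrite /cj_phi.
  under eq_bigr do rewrite mulrCA.
  rewrite -mulr_sumr mulf_eq0 gt_eqF ?sqrtr_gt0 //= => /eqP E; exact: E.
pose w k x := \sum_(i < n) v i * cj_density s (t + k) i x.
have W k : mu.-integrable I01 (EFin \o w k) /\ Rintegral mu I01 (w k) = 0.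
  have := integrable_lincomb mu I01 _ (index_enum 'I_n) v
    (fun i => cj_density s (t + k) i) (measurable_itv _)
    (integrable_cj_density s (t + k)).
  by case=> W1 W2; split; [exact: W1|exact: etrans W2 (I0 k)].
pose F x := \sum_(k < size q) q`_k * w k x.
have [intF IF] := integrable_lincomb mu I01 _ (index_enum 'I_(size q))
  (fun k => q`_k) (fun k => w k) (measurable_itv _) (fun k => proj1 (W k)).
(* [insub] recovers the ordinal index; its default 0 is never reached for [i < n]. *)
pose f := \poly_(i < n) (if insub i is Some j then v j else 0).
have fE x : f.[x] = \sum_i v i * x ^+ i.
  by rewrite horner_poly; apply: eq_bigr => i _; rewrite valK.
have FE x : 0 < x < 1 ->
    F x = x ^+ s / (1 + x) * cjw t x / (1 + x) ^+ n * f.[x] ^+ 2.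
  move=> x01; rewrite /F.
  transitivity (x ^+ s / (1 + x) * cjw t x * f.[x] * q.[cayley x]).
    rewrite (horner_coef q) mulr_sumr; apply: eq_bigr => k _.
    rewrite /w [LHS]mulr_sumr fE [X in _ = X * _]mulr_sumr mulr_suml.
    by apply: eq_bigr => i _; rewrite /cj_density !cjwE !exprD; ring.
  by rewrite qE // -fE expr2; ring.
have pos x : 0 < x < 1 -> 0 < x ^+ s / (1 + x) * cjw t x / (1 + x) ^+ n.
  move=> x01; have x1 : 0 < 1 + x by case/andP: x01 => x0 _; rewrite addr_gt0.
  have /andP[u0 _] : 0 < cayley x < 1 by apply: cayley_itv; rewrite /= in_itv.
  case/andP: x01 => x0 _.
  by rewrite cjwE !mulr_gt0 ?exprn_gt0 ?invr_gt0 ?exprn_gt0.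
(* With a positive weight, [F] vanishes exactly at the roots of [f] in (0, 1). *)
have f0 : f = 0.
  apply: (Rintegral_eq0_itv01 F f) => //.
  - by move=> x x01; rewrite FE // mulr_ge0 ?sqr_ge0 // ltW ?pos.
  - move=> x x01; rewrite FE // => /eqP.
    by rewrite mulf_eq0 gt_eqF ?pos //= sqrf_eq0.
  - by rewrite /F IF big1 // => k _; rewrite (proj2 (W k)) mulr0.
move=> i; have : f`_i = 0 by rewrite f0 coef0.
by rewrite coef_poly ltn_ord valK.
Qed.

Lemma cj_tau_neq0 s t n : cj_tau R s t n != 0.
Proof.
apply/negP => /det0P[v vnz vM].
pose Q k := \sum_(i < n) \sum_(j < n) v 0 i * v 0 j * cj_m R s (t + k) i j.
pose L k := \sum_(i < n) v 0 i * cj_phi R s (t + k) i.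
have QS k : Q k.+1 = Q k - L k ^+ 2.
  rewrite /Q /L expr2 mulr_suml -sumrB; apply: eq_bigr => i _.
  rewrite mulr_sumr -sumrB; apply: eq_bigr => j _.
  by rewrite addnS cj_mS; ring.
have vMj (j : 'I_n) : \sum_i v 0 i * cj_m R s t i j = 0.
  have /rowP/(_ j) := vM; rewrite !mxE => E; rewrite -[RHS]E.
  by apply: eq_bigr => i _; rewrite mxE.
have Q0 : Q 0%N = 0.
  rewrite /Q exchange_big big1 // => j _ /=.
  rewrite -[RHS](mulr0 (v 0 j)) -[X in _ = _ * X](vMj j) mulr_sumr.
  by apply: eq_bigr => i _; rewrite addn0; ring.
have Qni : {homo Q : k l / (k <= l)%N >-> l <= k}.
  by apply/nonincreasing_seqP => k; rewrite QS gerBl sqr_ge0.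
have Qlim : Q k @[k --> \oo] --> 0.
  have -> : 0 = \sum_(i < n) \sum_(j < n) v 0 i * v 0 j * 0 :> R.
    by rewrite big1 // => i _; rewrite big1 // => j _; rewrite mulr0.
  apply: cvg_big => [|i _]; first exact: add_continuous.
  apply: cvg_big => [|j _]; first exact: add_continuous.
  apply: cvgM; first exact: cvg_cst.
  exact: (cvg_comp _ _ (cvg_addnl t) (cvg_cj_m s i j)).
(* [Q] is nonincreasing, so it lies between its initial value and its limit, both 0. *)
have Qk k : Q k = 0.
  apply/eqP; rewrite eq_le -{1}Q0 Qni //=.
  by have := nonincreasing_cvgn_ge Qni (cvgP _ Qlim) k; rewrite (cvg_lim _ Qlim).
have L0 k : L k = 0.
  apply/eqP; rewrite -sqrf_eq0 -oppr_eq0; apply/eqP.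
  by rewrite -[RHS](Qk k.+1) QS Qk sub0r.
case/eqP: vnz; apply/rowP => i; rewrite mxE.
exact: (phi_moments_inj n s t (fun i => v 0 i) L0).
Qed.

End Nondegenerate.

(** * Specialisation of the abstract identity to the Cauchy-Jacobi moments *)

Theorem theorem2p9 (R : realType) (n s t : nat) :
  (1 <= n)%N -> cj_sigma R s t n.-1 != 0 ->
  cj_P R s t.+1 n + cj_d R s t n *: cj_P R s t.+1 n.-1
  = cj_P R s t n + cj_e R s t n *: cj_P R s t n.-1.
Proof.
case: n => // n _ /= s0.
(* Equality as functions lets the updated moments [m'] of [bipoly_rank1] be rewritten as those at
   [t.+1]. *)
have ES : cj_m R s t.+1 =
    fun i j => cj_m R s t i j - cj_phi R s t i * cj_phi R s t j.
  by apply/funext => i; apply/funext => j; exact: cj_mS.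
have := @bipoly_rank1 _ (cj_m R s t) (cj_phi R s t) n.
rewrite -ES; apply; by [exact: cj_tau_neq0|].
Qed.
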